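(* Let $n\ge 2$, let $z_1,\dots,z_n$ be distinct complex numbers, and let $a_1,\dots,a_n>0$ with $\sum_{i=1}^n a_i=1$. Let $w_1,\dots,w_{n-1}$ be the zeros, counted with multiplicity, of $f(z)=\sum_{i=1}^n \frac{a_i}{z-z_i}$. For $\lambda\in\mathbb{C}\setminus\{0\}$ and $\mu\in\mathbb{C}$ put $W(\lambda,\mu)=(\lambda w_1+\mu,\dots,\lambda w_{n-1}+\mu)$ and $Z(\lambda,\mu)=(\lambda z_1+\mu,\dots,\lambda z_n+\mu)$, and put $$\mathbf{a}=\Big(\tfrac{1}{n-1},\dots,\tfrac{1}{n-1}\Big)\in\mathbb{R}^{n-1},\qquad \mathbf{b}=\Big(\tfrac{1-a_1}{n-1},\dots,\tfrac{1-a_n}{n-1}\Big)\in\mathbb{R}^{n}.$$ Then there exists a row stochastic $(n-1)\times n$ matrix $R$ such that $\mathbf{b}=\mathbf{a}R$ and $W(\lambda,\mu)^T=R\,Z(\lambda,\mu)^T$ for all $\lambda\in\mathbb{C}\setminus\{0\}$ and $\mu\in\mathbb{C}$, so that $(W(\lambda,\mu),\mathbf{a})\prec(Z(\lambda,\mu),\mathbf{b})$. Equivalently, for all such $\lambda,\mu$ the inequality $$\sum_{j=1}^{n-1}\Phi(\lambda w_j+\mu)\le\sum_{i=1}^n(1-a_i)\,\Phi(\lambda z_i+\mu)$$ holds for every (continuous) convex function $\Phi:\mathbb{C}\to\mathbb{R}$.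
   Context: $\mathbb{C}$ is identified with $\mathbb{R}^2$ when speaking of convex functions. A row stochastic matrix is a matrix with nonnegative real entries all of whose row sums equal $1$. Weighted majorization: let $X=(x_1,\dots,x_m)\in\mathbb{C}^m$, $Y=(y_1,\dots,y_l)\in\mathbb{C}^l$, and let $\mathbf{p}=(p_1,\dots,p_m)$, $\mathbf{q}=(q_1,\dots,q_l)$ be vectors of positive weights each with sum $1$. One writes $(X,\mathbf{p})\prec(Y,\mathbf{q})$ if $\sum_i p_i\Phi(x_i)\le\sum_j q_j\Phi(y_j)$ for every convex $\Phi:\mathbb{C}\to\mathbb{R}$; by a theorem of Sherman this is equivalent to the existence of a row stochastic $m\times l$ matrix $R$ with $X^T=RY^T$ and $\mathbf{q}=\mathbf{p}R$. *)

(* Defs.v *)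
From HB Require Import structures.
From mathcomp Require Import all_boot all_order all_algebra.
From mathcomp Require Import classical_sets reals convex.
From mathcomp Require Import complex.

Set Implicit Arguments.
Unset Strict Implicit.
Unset Printing Implicit Defensive.

Import Order.TTheory GRing.Theory Num.Theory.

Local Open Scope ring_scope.
Local Open Scope complex_scope.

(* Rational functions over F are elements of {fraction {poly F}}.  For k = 0
   the predicate says that x is neither a zero nor a pole of f; at a pole it
   fails for every k. *)
Definition zero_of_order (F : fieldType) (f : {fraction {poly F}}) (x : F)
    (k : nat) : Prop :=
  exists p q : {poly F},
    [/\ p.[x] != 0, q.[x] != 0
      & f = tofrac (('X - x%:P) ^+ k) * (tofrac p / tofrac q)].

(* The value x occurs exactly k > 0 times in w iff it is a zero of f of
   multiplicity k; in particular poles of f do not occur in w. *)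
Definition zeros_with_multiplicity (F : fieldType) (m : nat)
    (f : {fraction {poly F}}) (w : 'rV[F]_m) : Prop :=
  forall (x : F) (k : nat), (0 < k)%N ->
    zero_of_order f x k <-> #|[set j : 'I_m | w 0 j == x]| = k.

Definition cauchy_sum (R : rcfType) (n : nat) (a : 'rV[R]_n) (z : 'rV[R[i]]_n)
    : {fraction {poly R[i]}} :=
  \sum_(i < n) tofrac ((a 0 i)%:C)%:P / tofrac ('X - (z 0 i)%:P).

Definition row_stochastic (R : numDomainType) (m l : nat) (M : 'M[R]_(m, l))
    : Prop :=
  (forall i j, 0 <= M i j) /\ (forall i, \sum_(j < l) M i j = 1).

Definition weight_vector (R : numDomainType) (m : nat) (p : 'rV[R]_m) : Prop :=
  (forall i, 0 < p 0 i) /\ \sum_(i < m) p 0 i = 1.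

(* [Rcomplex R] is R[i] viewed as a two-dimensional real vector space. *)
Definition convex_on_complex (R : rcfType) (Phi : R[i] -> R) : Prop :=
  @convex_function R (Rcomplex R) [set: Rcomplex R]%classic Phi.

Definition weighted_majorized (R : rcfType) (m l : nat)
    (X : 'rV[R[i]]_m) (p : 'rV[R]_m) (Y : 'rV[R[i]]_l) (q : 'rV[R]_l) : Prop :=
  [/\ weight_vector p, weight_vector q
    & forall Phi : R[i] -> R, convex_on_complex Phi ->
        \sum_(i < m) p 0 i * Phi (X 0 i) <= \sum_(j < l) q 0 j * Phi (Y 0 j)].

Definition affine_image (F : nzRingType) (m : nat) (la mu : F) (v : 'rV[F]_m)
    : 'rV[F]_m :=
  \row_(j < m) (la * v 0 j + mu).

(* Main.v *)
(** Let v = (sqrt a_i), a unit vector, and let D = diag(z_i).  The cofactor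
    formula applied to X - D in an orthonormal basis starting with v shows that
    the compression of D to the orthogonal complement of v has characteristic
    polynomial f(X) \prod_i (X - z_i), so its eigenvalues are the w_j.  Schur
    triangularization gives an orthonormal basis u_j of that complement with
    w_j = <D u_j, u_j> = \sum_i |u_ji|^2 z_i.  The matrix S_ji = |u_ji|^2 has
    row sums 1, and its i-th column sums to 1 - a_i because (v, u_1, ...) is
    unitary; Jensen's inequality then gives the majorization. *)

Require Import Defs.
From HB Require Import structures.
From mathcomp Require Import all_boot all_order all_algebra.
From mathcomp Require Import classical_sets reals convex.
From mathcomp Require Import complex.
From mathcomp Require Import perm interval_inference.

Set Implicit Arguments.
Unset Strict Implicit.
Unset Printing Implicit Defensive.

Import Order.TTheory GRing.Theory Num.Theory.

Local Open Scope ring_scope.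
Local Open Scope complex_scope.

(** * Characteristic polynomials under conjugation and compression *)

Lemma char_poly_mx_conj (R : comNzRingType) (m : nat) (A P Q : 'M[R]_m) :
  P *m Q = 1%:M ->
  char_poly_mx (P *m A *m Q)
  = map_mx polyC P *m char_poly_mx A *m map_mx polyC Q.
Proof.
move=> PQ1; rewrite /char_poly_mx !map_mxM mulmxBr mulmxBl scalar_mxC.
rewrite -(mulmxA _ (map_mx _ P)) -[map_mx _ P *m map_mx _ Q]map_mxM.
by rewrite PQ1 map_mx1 mulmx1.
Qed.

Lemma char_poly_conj (R : comNzRingType) (m : nat) (A P Q : 'M[R]_m) :
  P *m Q = 1%:M -> char_poly (P *m A *m Q) = char_poly A.
Proof.
move=> PQ1; rewrite /char_poly char_poly_mx_conj // !det_mulmx mulrAC.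
by rewrite -det_mulmx -map_mxM PQ1 map_mx1 det1 mul1r.
Qed.

Section Compression.

Local Open Scope sesquilinear_scope.

Variables (C : numClosedFieldType) (m : nat).
Implicit Types (U : 'M[C]_m.+1) (v z : 'rV[C]_m.+1).

(** The left side is entry (0, 0) of the adjugate of [N], the characteristic matrix of diag(z)
    conjugated by [U]. Since [N] is diag(X - z_i) conjugated by [U], its adjugate is the same
    conjugate of diag(e), where e_i is the product of the X - z_k with k different from i. *)
Lemma char_poly_unitary_compression U z : U \is unitarymx ->
  char_poly (row' 0 U *m diag_mx z *m (row' 0 U)^t*) =
  \sum_i (U 0 i * (U 0 i)^*)%:P * \prod_(k | k != i) ('X - (z 0 k)%:P).
Proof.
move=> Uunitary.
pose P := map_mx polyC U; pose P' := map_mx polyC (U^t*).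
have PP' : P *m P' = 1%:M by rewrite -map_mxM (unitarymxP Uunitary) map_mx1.
have P'P : P' *m P = 1%:M by exact: mulmx1C.
pose d : 'rV[{poly C}]_m.+1 := \row_i ('X - (z 0 i)%:P).
pose e : 'rV[{poly C}]_m.+1 := \row_i \prod_(k | k != i) d 0 k.
pose N := char_poly_mx (U *m diag_mx z *m U^t*).
have dE : char_poly_mx (diag_mx z) = diag_mx d.
  apply/matrixP=> i j; rewrite !mxE.
  by case: eqVneq => _; rewrite ?mulr1n // !mulr0n subr0.
have NE : N = P *m diag_mx d *m P'.
  by rewrite /N char_poly_mx_conj ?dE //; apply/unitarymxP.
pose p := \prod_k d 0 k.
have detN : \det N = p.
  rewrite -[LHS]/(char_poly _) char_poly_conj; last exact/unitarymxP.
  by rewrite /char_poly dE det_diag.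
have NG : N *m (P *m diag_mx e *m P') = p%:M.
  rewrite NE -!mulmxA (mulmxA P') P'P mul1mx (mulmxA (diag_mx d)) mulmx_diag.
  have -> : diag_mx (\row_j (d 0 j * e 0 j)) = p%:M.
    rewrite -diag_const_mx; congr diag_mx; apply/rowP=> j.
    by rewrite !mxE /p [RHS](bigD1 j) //= mxE.
  by rewrite mulmxA scalar_mxC -mulmxA PP' mulmx1.
have p0 : p != 0.
  by apply/prodf_neq0 => k _; rewrite mxE polyXsubC_eq0.
(* Multiplying [NG] on the left by [\adj N] gives [p] times both sides, and the nonzero polynomial
   [p] cancels entrywise. *)
have adjN : \adj N = P *m diag_mx e *m P'.
  have := congr1 (mulmx (\adj N)) NG.
  rewrite mulmxA mul_adj_mx detN mul_scalar_mx mul_mx_scalar => /matrixP E.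
  by apply/matrixP=> i j; have := E i j; rewrite !mxE => /(mulfI p0) <-.
have -> : row' 0 U *m diag_mx z *m (row' 0 U)^t*
          = row' 0 (col' 0 (U *m diag_mx z *m U^t*)).
  apply/matrixP=> i j; rewrite !mxE; apply: eq_bigr => k _; rewrite !mxE.
  by congr (_ * _); apply: eq_bigr => l _; rewrite !mxE.
rewrite /char_poly -row'_col'_char_poly_mx -/N.
transitivity ((\adj N) 0 0).
  by rewrite /adjugate mxE /cofactor expr0 mul1r.
rewrite adjN mxE; apply: eq_bigr => k _.
rewrite mul_mx_diag !mxE mulrAC polyCM; congr (_ * _).
by apply: eq_bigr => l _; rewrite mxE.
Qed.

(** Gram-Schmidt, run on the matrix all of whose rows equal [v], yields a unitary matrix whose row 0
    spans the line of [v]. The two vectors differ by a scalar [c] of modulus 1, which disappears in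
    squared moduli. *)
Lemma unitary_row_norms v : \sum_i v 0 i * (v 0 i)^* = 1 ->
  exists2 U : 'M[C]_m.+1, U \is unitarymx
    & forall i, U 0 i * (U 0 i)^* = v 0 i * (v 0 i)^*.
Proof.
move=> v1; pose A : 'M[C]_m.+1 := \matrix_(i, j) v 0 j.
have BU := schmidt_unitarymx A (leqnn _); set B := schmidt A in BU.
exists B => // i.
have := row_schmidt_sub A 0.
rewrite (bigD1 0) //= big1 ?addsmx0; last first.
  by move=> k /andP[]; rewrite leqn0 => k0 /negP[]; exact: k0.
rewrite genmxE => /sub_rVP[c /rowP vE].
have {}vE j : v 0 j = c * B 0 j by have := vE j; rewrite !mxE.
have B1 : \sum_i B 0 i * (B 0 i)^* = 1.
  have /matrixP/(_ 0 0) := unitarymxP BU; rewrite !mxE eqxx mulr1n => <-.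
  by apply: eq_bigr => k _; rewrite !mxE.
have c1 : c * c^* = 1.
  rewrite -v1 -[LHS]mulr1 -B1 mulr_sumr; apply: eq_bigr => k _.
  by rewrite vE rmorphM mulrACA.
by rewrite vE rmorphM mulrACA c1 mul1r.
Qed.

End Compression.

(* The rows of u are an orthonormal basis of the orthogonal complement of v
   that triangularizes the compression of diag(z) to it. *)
Lemma weighted_interlacing_basis (C : numClosedFieldType) (m : nat)
    (v z : 'rV[C]_m.+2) : \sum_i v 0 i * (v 0 i)^* = 1 ->
  exists u : 'M[C]_(m.+1, m.+2),
    [/\ forall j, \sum_i u j i * (u j i)^* = 1,
        forall i, \sum_j u j i * (u j i)^* = 1 - v 0 i * (v 0 i)^*
      & \sum_i (v 0 i * (v 0 i)^*)%:P * \prod_(k | k != i) ('X - (z 0 k)%:P)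
        = \prod_j ('X - (\sum_i u j i * (u j i)^* * z 0 i)%:P)].
Proof.
move=> /unitary_row_norms[U Uunitary Uv].
have [Q Qunitary] := @Schur _ _
  (row' 0 U *m diag_mx z *m (row' 0 U)^t*)%sesqui (ltn0Sn m).
rewrite /similar_to conjymx // => trig.
pose u := Q *m row' 0 U.
have uu : (u *m diag_mx z *m u^t*)%sesqui =
    (Q *m (row' 0 U *m diag_mx z *m (row' 0 U)^t*) *m Q^t*)%sesqui.
  by rewrite /u trmx_mul map_mxM !mulmxA.
have Wu : row' 0 U \is unitarymx.
  apply/unitarymxP/matrixP=> i j; rewrite mxE.
  have /matrixP/(_ (lift 0 i) (lift 0 j)) := unitarymxP Uunitary.
  rewrite !mxE (inj_eq lift_inj) => <-.
  by apply: eq_bigr => k _; rewrite !mxE.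
exists u; split.
- move=> j; have /unitarymxP/matrixP/(_ j j) := mul_unitarymx Qunitary Wu.
  rewrite mxE [in RHS]mxE eqxx mulr1n => <-.
  by apply: eq_bigr => k _; rewrite !mxE.
- move=> i.
  (* [Q] is square and unitary, so it drops out of the Gram matrix of the columns. *)
  have uE : ((u^t*) *m u = (row' 0 U)^t* *m row' 0 U)%sesqui.
    rewrite /u trmx_mul map_mxM !mulmxA; congr (_ *m _).
    by rewrite mulmxKtV.
  (* Column [i] of [U] has norm 1; row 0 contributes the squared modulus of v_i, and the other rows
     contribute the wanted sum. *)
  have /matrixP/(_ i i) := mulmx1C (unitarymxP Uunitary).
  rewrite !mxE eqxx mulr1n big_ord_recl !mxE => <-.
  rewrite -Uv [U 0 i * _]mulrC addrAC subrr add0r.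
  transitivity (((u^t*) *m u)%sesqui i i).
    by rewrite mxE; apply: eq_bigr => k _; rewrite mulrC !mxE.
  by rewrite uE mxE; apply: eq_bigr => k _; rewrite !mxE.
transitivity (char_poly (row' 0 U *m diag_mx z *m (row' 0 U)^t*)%sesqui).
  by rewrite char_poly_unitary_compression //;
    apply: eq_bigr => i _; rewrite Uv.
(* Conjugation by [Q] keeps the characteristic polynomial and makes the matrix triangular, so the
   roots are its diagonal entries. *)
rewrite -(char_poly_conj _ (unitarymxP Qunitary)) -uu char_poly_trig ?uu //.
apply: eq_bigr => j _; congr ('X - _%:P).
by rewrite -uu mul_mx_diag !mxE; apply: eq_bigr => k _; rewrite !mxE mulrAC.
Qed.

(** * Zeros of the Cauchy sum as roots of its numerator *)

Lemma cauchy_sumE (R : rcfType) (n : nat) (a : 'rV[R]_n) (z : 'rV[R[i]]_n) :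
  cauchy_sum a z =
  tofrac (\sum_i ((a 0 i)%:C)%:P * \prod_(k | k != i) ('X - (z 0 k)%:P))
  / tofrac (\prod_k ('X - (z 0 k)%:P)).
Proof.
rewrite /cauchy_sum rmorph_sum mulr_suml /=; apply: eq_bigr => i _.
have -> : \prod_k ('X - (z 0 k)%:P) =
    ('X - (z 0 i)%:P) * \prod_(k | k != i) ('X - (z 0 k)%:P) by rewrite (bigD1 i).
rewrite !tofracM -mulf_div divff ?mulr1 //.
by rewrite tofrac_eq0; apply/prodf_neq0 => k _; rewrite polyXsubC_eq0.
Qed.

(** No root of the numerator cancels against [p], so the zeros of the fraction are the t_j with the
    same multiplicities. Every value thus occurs equally often in [t] and [w], which makes them
    permutations of each other. *)
Lemma zeros_of_fraction (F : fieldType) (m : nat) (p : {poly F})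
    (t w : 'rV[F]_m) : p != 0 -> (forall j, p.[t 0 j] != 0) ->
  zeros_with_multiplicity
    (tofrac (\prod_j ('X - (t 0 j)%:P)) / tofrac p) w ->
  exists s : 'S_m, forall j, w 0 j = t 0 (s j).
Proof.
set g := \prod_j _ => p0 pt wzeros.
pose ts := [tuple t 0 j | j < m]; pose ws := [tuple w 0 j | j < m].
have gE : g = \prod_(x <- ts) ('X - x%:P).
  by rewrite big_tuple; apply: eq_bigr => j _; rewrite tnth_mktuple.
have g0 : g != 0 by rewrite gE monic_neq0 ?monic_prod_XsubC.
have countw x : #|[set j : 'I_m | w 0 j == x]| = count_mem x ws.
  rewrite cardE size_filter -enumT /= count_map; apply: eq_count => j.
  by rewrite !inE.
have countE x : count_mem x ts = count_mem x ws.
  case: (posnP (count_mem x ts)) => [ts0 | ts_gt0]; last first.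
    rewrite -countw; apply/esym/wzeros => //.
    have [j xE] : exists j, x = t 0 j.
      move: ts_gt0; rewrite -has_count => /hasP[y /mapP[j _ ->]] /eqP <-.
      by exists j.
    have [k [h]] := multiplicity_XsubC g x; rewrite g0 /= => hx gh.
    have -> : count_mem x ts = k.
      by rewrite -mu_prod_XsubC -gE gh mupMr // mup_XsubCX eqxx.
    exists h, p; rewrite xE pt -xE; split=> //.
    by rewrite gh tofracM mulrA [tofrac h * _]mulrC.
  (* A value [x] of [w] outside [t] would be a zero of positive order. Clearing denominators and
     evaluating at [x] forces g(x) = 0, a contradiction; this also excludes poles. *)
  rewrite ts0; apply/esym/eqP; rewrite -leqn0 leqNgt; apply/negP => ws_gt0.
  have [q1 [q2 [q1x q2x]]] := (wzeros x _ ws_gt0).2 (countw x).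
  have q20 : q2 != 0 by apply: contra_neq q2x => ->; rewrite horner0.
  rewrite mulrA -tofracM => /eqP.
  rewrite eqr_div ?tofrac_eq0 // -!tofracM tofrac_eq.
  move=> /eqP/(congr1 (horner^~ x)).
  rewrite !hornerM horner_exp hornerXsubC subrr expr0n eqn0Ngt ws_gt0 !mul0r.
  move/eqP; rewrite mulf_eq0 (negPf q2x) orbF.
  by rewrite -[_ == 0]/(root g x) gE root_prod_XsubC -has_pred1 has_count ts0.
have /tuple_permP[s sE] : perm_eq ws ts.
  by apply/allP => x _ /=; rewrite countE.
exists s => j.
have := congr1 (fun r => nth 0 r j) sE.
by rewrite !nth_mktuple tnth_mktuple.
Qed.

(** Being nonnegative in the order of [R[i]] includes having imaginary part 0. This lets squared
    moduli serve as entries of a real matrix. *)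
Lemma mulC_conjE (R : rcfType) (x : R[i]) :
  (x * x^*)%R = (complex.Re (x * x^*)%R)%:C.
Proof.
have := mul_conjC_ge0 x; move: (x * _) => [y1 y2].
by rewrite lecE /= => /andP[/eqP -> _].
Qed.

(** * Jensen's inequality on the complex plane and majorization *)

Section Convexity.

Variables (R : realType) (Phi : R[i] -> R).
Hypothesis Phi_convex : convex_on_complex Phi.

(** Translates the abstract convex combination in [Rcomplex R] into complex arithmetic, by comparing
    coordinates. *)
Lemma convex_on_complexP (t : R) (x y : R[i]) : 0 <= t -> t <= 1 ->
  Phi (t%:C * x + (1 - t)%:C * y) <= t * Phi x + (1 - t) * Phi y.
Proof.
move=> t0 t1; have := Phi_convex (Itv01 t0 t1) (in_setT x) (in_setT y).
set c := conv _ _ _; set d := conv _ _ _.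
have -> : c = t%:C * x + (1 - t)%:C * y.
  rewrite /c /d; case: x y {c d} => [x1 x2] [y1 y2].
  apply/eqP; rewrite eq_complex /=.
  by rewrite /unstable.onem !mul0r !addr0 !subr0 !eqxx.
done.
Qed.

Lemma jensen_complex (n : nat) (t : 'I_n -> R) (x : 'I_n -> R[i]) :
  (forall i, 0 <= t i) -> \sum_i t i = 1 ->
  Phi (\sum_i (t i)%:C * x i) <= \sum_i t i * Phi (x i).
Proof.
elim: n t x => [|n IHn] t x t0.
  by rewrite big_ord0 => /eqP; rewrite eq_sym oner_eq0.
rewrite big_ord_recl => t1.
pose s := \sum_(i < n) t (lift ord0 i).
have sE : s = 1 - t ord0 by rewrite -t1 addrC addKr.
have s0 : 0 <= s by apply: sumr_ge0.
rewrite !big_ord_recl.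
(* The induction renormalizes the remaining weights by [s]; if [s] is 0, all the mass sits at the
   first point. *)
case: (eqVneq s 0) => [s_eq0 | s_neq0].
  have tl i : t (lift ord0 i) = 0.
    by move/eqP: s_eq0; rewrite psumr_eq0 // =>
      /allP/(_ i (mem_index_enum _))/eqP.
  have t01 : t ord0 = 1 by apply/eqP; rewrite eq_sym -subr_eq0 -sE s_eq0.
  by rewrite !big1 ?t01 ?mul1r ?addr0 // => i _; rewrite tl mul0r.
have -> : \sum_(i < n) (t (lift ord0 i))%:C * x (lift ord0 i) =
    (1 - t ord0)%:C * \sum_(i < n) (t (lift ord0 i) / s)%:C * x (lift ord0 i).
  rewrite mulr_sumr; apply: eq_bigr => i _.
  by rewrite mulrA -rmorphM -sE mulrC (mulrC s) divfK // mulrC.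
apply: le_trans (convex_on_complexP _ _ _ _) _ => //.
  by rewrite -subr_ge0 -sE.
rewrite lerD2l -sE.
have -> : \sum_(i < n) t (lift ord0 i) * Phi (x (lift ord0 i)) =
    s * \sum_(i < n) (t (lift ord0 i) / s) * Phi (x (lift ord0 i)).
  by rewrite mulr_sumr; apply: eq_bigr => i _; rewrite mulrA mulrCA divff ?mulr1.
apply: ler_wpM2l => //; apply: IHn => [i|]; first by rewrite divr_ge0.
by rewrite -mulr_suml divff.
Qed.

End Convexity.

(** The easy direction of Sherman's theorem: apply Jensen to each row of [S], then average with the
    weights [p] and exchange the sums. *)
Lemma row_stochastic_majorized (R : realType) (m l : nat) (S : 'M[R]_(m, l))
    (X : 'rV[R[i]]_m) (p : 'rV[R]_m) (Y : 'rV[R[i]]_l) (q : 'rV[R]_l) :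
  weight_vector p -> weight_vector q -> row_stochastic S -> q = p *m S ->
  X^T = map_mx (fun x : R => x%:C) S *m Y^T -> weighted_majorized X p Y q.
Proof.
move=> pw qw [S0 S1] qE XE; split=> // Phi Phi_convex.
have -> : \sum_j q 0 j * Phi (Y 0 j) =
    \sum_i p 0 i * \sum_j S i j * Phi (Y 0 j).
  under [RHS]eq_bigr do rewrite mulr_sumr.
  rewrite exchange_big; apply: eq_bigr => j _; rewrite qE mxE mulr_suml.
  by apply: eq_bigr => i _; rewrite mulrA.
apply: ler_sum => i _; apply: ler_wpM2l; first exact/ltW/pw.1.
have -> : X 0 i = \sum_j (S i j)%:C * Y 0 j.
  have /matrixP/(_ i 0) := XE; rewrite !mxE => ->.
  by apply: eq_bigr => j _; rewrite !mxE.
exact: (jensen_complex Phi_convex _ (S0 i) (S1 i)).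
Qed.

(** * Assembling the stochastic matrix from the orthonormal basis *)

Theorem theorem2 (R : realType) (n : nat) (z : 'rV[R[i]]_n) (a : 'rV[R]_n)
    (w : 'rV[R[i]]_(n.-1)) :
  (2 <= n)%N ->
  injective (fun i : 'I_n => z 0 i) ->
  (forall i : 'I_n, 0 < a 0 i) ->
  \sum_(i < n) a 0 i = 1 ->
  zeros_with_multiplicity (cauchy_sum a z) w ->
  let wa : 'rV[R]_(n.-1) := \row_(j < n.-1) (n.-1%:R)^-1 in
  let wb : 'rV[R]_n := \row_(i < n) ((1 - a 0 i) / n.-1%:R) in
  [/\ exists S : 'M[R]_(n.-1, n),
        [/\ row_stochastic S,
            wb = wa *m S
          & forall la mu : R[i], la != 0 ->
              (affine_image la mu w)^T =
                map_mx (fun x : R => x%:C) S *m (affine_image la mu z)^T],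
      forall la mu : R[i], la != 0 ->
        weighted_majorized (affine_image la mu w) wa (affine_image la mu z) wb
    & forall la mu : R[i], la != 0 ->
        forall Phi : R[i] -> R, convex_on_complex Phi ->
          \sum_(j < n.-1) Phi (la * w 0 j + mu) <=
            \sum_(i < n) (1 - a 0 i) * Phi (la * z 0 i + mu)].
Proof.
case: n z a w => [|[|m]] // z a w _ z_inj a_gt0 a_sum1 w_zeros wa wb.
pose v : 'rV[R[i]]_m.+2 := \row_i (Num.sqrt (a 0 i))%:C.
have vE i : (v 0 i * (v 0 i)^*)%R = (a 0 i)%:C.
  rewrite !mxE -[Num.conj _]/(conjc _) conjc_real -rmorphM -expr2.
  by rewrite sqr_sqrtr ?ltW.
have v1 : \sum_i (v 0 i * (v 0 i)^*)%R = 1.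
  by under eq_bigr do rewrite vE; rewrite -rmorph_sum a_sum1.
have [u [u_rows u_cols gE]] := weighted_interlacing_basis z v1.
pose t : 'rV[R[i]]_m.+1 := \row_j \sum_i (u j i * (u j i)^* * z 0 i)%R.
pose p := \prod_k ('X - (z 0 k)%:P).
pose g := \sum_i ((a 0 i)%:C)%:P * \prod_(k | k != i) ('X - (z 0 k)%:P).
have {}gE : g = \prod_j ('X - (t 0 j)%:P).
  rewrite /t; under [RHS]eq_bigr do rewrite mxE.
  by rewrite -gE; apply: eq_bigr => i _; rewrite vE.
(* At z_i only the [i]-th summand survives, and it is nonzero because the z_k are distinct. Hence
   [g] and [p] have no common root. *)
have gz i : g.[z 0 i] != 0.
  rewrite horner_sum (bigD1 i) //= [X in _ + X]big1 ?addr0 => [|k ki]; last first.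
    rewrite hornerM horner_prod (bigD1 i) 1?eq_sym //=.
    by rewrite hornerXsubC subrr mul0r mulr0.
  rewrite hornerM hornerC mulf_neq0 //.
    by rewrite (inj_eq (@complexI R) _ 0) gt_eqF.
  rewrite horner_prod; apply/prodf_neq0 => k ki.
  by rewrite hornerXsubC subr_eq0 eq_sym (inj_eq z_inj).
have pt j : p.[t 0 j] != 0.
  rewrite horner_prod; apply/prodf_neq0 => i _.
  rewrite hornerXsubC subr_eq0; apply: contra_neq (gz i) => <-.
  by rewrite gE horner_prod (bigD1 j) //= hornerXsubC subrr mul0r.
have p0 : p != 0 by apply/prodf_neq0 => k _; rewrite polyXsubC_eq0.
have [s sE] : exists s : 'S_m.+1, forall j, w 0 j = t 0 (s j).
  by apply: zeros_of_fraction p0 pt _; rewrite -gE -cauchy_sumE.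
(* Rows are permuted by [s] to follow the given order of [w]; [Re] only changes the type of entries
   that are already real. *)
pose S : 'M[R]_(m.+1, m.+2) :=
  \matrix_(j, i) complex.Re (u (s j) i * (u (s j) i)^*)%R.
have SE j i : (S j i)%:C = (u (s j) i * (u (s j) i)^*)%R.
  by rewrite mxE -mulC_conjE.
have S_stoch : row_stochastic S.
  split=> [j i | j]; first by rewrite -lecR SE mul_conjC_ge0.
  apply: (@complexI R); rewrite rmorph_sum rmorph1 -[RHS](u_rows (s j)).
  by apply: eq_bigr => i _; rewrite -SE.
have S_cols i : \sum_j S j i = 1 - a 0 i.
  apply: (@complexI R); rewrite rmorph_sum rmorphB rmorph1 /= -vE -u_cols.
  rewrite [RHS](reindex_inj (@perm_inj _ s)) /=.
  by apply: eq_bigr => j _; rewrite SE.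
have n0 : (m.+1%:R : R) != 0 by rewrite pnatr_eq0.
have wbE : wb = wa *m S.
  apply/rowP=> i; rewrite !mxE -S_cols mulrC mulr_sumr.
  by apply: eq_bigr => j _; rewrite !mxE.
(* The unit row sums of [S] carry the translation by [mu] through, so one matrix serves all [la] and
   [mu]. *)
have wSz (la mu : R[i]) : (affine_image la mu w)^T =
    map_mx (fun x : R => x%:C) S *m (affine_image la mu z)^T.
  apply/matrixP=> j k; rewrite !mxE sE mxE.
  transitivity (\sum_i (S j i)%:C * (la * z 0 i + mu)); last first.
    by apply: eq_bigr => i _; rewrite !mxE.
  under [RHS]eq_bigr do rewrite mulrDr.
  rewrite big_split /= -mulr_suml -rmorph_sum S_stoch.2 mul1r; congr (_ + _).
  by rewrite mulr_sumr; apply: eq_bigr => i _; rewrite -SE mulrCA.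
have wa_weight : weight_vector wa.
  split=> [j|]; first by rewrite mxE invr_gt0 ltr0n.
  under eq_bigr do rewrite mxE.
  by rewrite sumr_const card_ord -[LHS]mulr_natl mulfV.
have wb_weight : weight_vector wb.
  split=> [i|].
    (* 1 - a_i is the sum of the other weights, and with at least two points the index [lift i 0]
       supplies a positive one. *)
    rewrite mxE divr_gt0 ?ltr0n // -a_sum1 (bigD1 i) //= addrAC subrr add0r.
    rewrite (bigD1 (lift i 0)) 1?eq_sym ?neq_lift //= ltr_wpDr ?a_gt0 //.
    by apply: sumr_ge0 => k _; exact/ltW.
  under eq_bigr do rewrite mxE.
  rewrite -mulr_suml sumrB a_sum1 sumr_const card_ord.
  by rewrite -natr1 addrK mulfV.
have maj la mu : weighted_majorized (affine_image la mu w) wa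
    (affine_image la mu z) wb.
  exact: row_stochastic_majorized (wSz la mu).
split; [by exists S; split | by [] |].
move=> la mu _ Phi Phi_convex.
have [_ _ /(_ Phi Phi_convex)] := maj la mu.
(* The weights on both sides share the factor 1/(n-1), which is cancelled. *)
under eq_bigr do rewrite !mxE.
under [leRHS]eq_bigr do rewrite !mxE mulrAC.
by rewrite -mulr_sumr -mulr_suml mulrC ler_pM2r ?invr_gt0 ?ltr0n.
Qed.
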